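(* Let $$\mathbf{T}=\left(\mathbf{I}-\mathbf{P}^{-1}\mathbf{M}\right)\left(\mathbf{I}-\mathbf{T}_C^F\,\tilde{\mathbf{P}}^{-1}\,\mathbf{T}_F^C\,\mathbf{M}\right)\in\mathbb{R}^{LMN\times LMN},$$ where $\mathbf{M}$ is the composite collocation matrix, $\mathbf{P},\tilde{\mathbf{P}}$ are the (invertible) fine and coarse preconditioners, and $\mathbf{T}_C^F,\mathbf{T}_F^C$ are circulant interweaved transfer operators in space, all as defined in the context, with the spatial matrices $A$ and $\tilde A$ diagonalized by the Fourier matrices $\boldsymbol\Psi$ and $\boldsymbol\Psi_C$, respectively. Then there exists a transformation (invertible matrix) $\mathcal{F}$ such that $$\mathcal{F}^{-1}\mathbf{T}\mathcal{F}=\mathrm{diag}\left(\mathcal{B}^{(S)}_0\mathcal{B}^{(CGC)}_0,\ldots,\mathcal{B}^{(S)}_{\frac N2-1}\mathcal{B}^{(CGC)}_{\frac N2-1}\right),$$ with $2LM\times 2LM$ blocks $$\mathcal{B}^{(S)}_k=\begin{pmatrix}\mathbf{I}-\left(\mathbf{B}^{(P)}_k\right)^{-1}\mathbf{B}^{(M)}_k&0\\0&\mathbf{I}-\left(\mathbf{B}^{(P)}_{\frac N2+k}\right)^{-1}\mathbf{B}^{(M)}_{\frac N2+k}\end{pmatrix},$$ $$\mathcal{B}^{(CGC)}_k=\begin{pmatrix}\mathbf{I}-f_kd_k\left(\mathbf{B}^{(\tilde P)}_k\right)^{-1}\mathbf{B}^{(M)}_k&-\hat f_kd_k\left(\mathbf{B}^{(\tilde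 P)}_k\right)^{-1}\mathbf{B}^{(M)}_{\frac N2+k}\\-\hat d_kf_k\left(\mathbf{B}^{(\tilde P)}_k\right)^{-1}\mathbf{B}^{(M)}_k&\mathbf{I}-\hat f_k\hat d_k\left(\mathbf{B}^{(\tilde P)}_k\right)^{-1}\mathbf{B}^{(M)}_{\frac N2+k}\end{pmatrix},$$ for $k=0,\ldots,\frac N2-1$. Here the $LM\times LM$ basic blocks depend, as far as the spatial problem is concerned, solely on the eigenvalues of $A$ and $\tilde A$: up to the permutation that reorders the tensor layers $(L,M,N)$ into $(N,L,M)$ (respectively $(L,M,N/2)$ into $(N/2,L,M)$), the spatial Fourier transformation ($\mathbf{I}_L\otimes\mathbf{I}_M\otimes\boldsymbol\Psi$, respectively $\mathbf{I}_L\otimes\mathbf{I}_M\otimes\boldsymbol\Psi_C$) transforms $\mathbf{P}$, $\mathbf{M}$, $\tilde{\mathbf{P}}$ by similarity into $\mathrm{diag}(\mathbf{B}^{(P)}_0,\ldots,\mathbf{B}^{(P)}_{N-1})$, $\mathrm{diag}(\mathbf{B}^{(M)}_0,\ldots,\mathbf{B}^{(M)}_{N-1})$, $\mathrm{diag}(\mathbf{B}^{(\tilde P)}_0,\ldots,\mathbf{B}^{(\tilde P)}_{\frac N2-1})$, where $$\mathbf{B}^{(P)}_j=\mathbf{I}_L\otimes\mathbf{I}_M-\mathbf{E}\otimes\mathbf{N}_M-\lambda^{(A)}_j\Delta t\,\mathbf{I}_L\otimes\mathbf{Q}_\Delta,$$ $$\mathbf{B}^{(M)}_j=\mathbf{I}_L\otimes\mathbf{I}_M-\mathbf{E}\otimes\mathbf{N}_M-\lambda^{(A)}_j\Delta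 t\,\mathbf{I}_L\otimes\mathbf{Q},$$ $$\mathbf{B}^{(\tilde P)}_j=\mathbf{I}_L\otimes\mathbf{I}_M-\mathbf{E}\otimes\mathbf{N}_M-\lambda^{(\tilde A)}_j\Delta t\,\mathbf{I}_L\otimes\mathbf{Q}_\Delta .$$
   Context: Let $N$ be even (number of fine spatial grid points on a periodic grid), $M$ the number of quadrature nodes per subinterval, $L$ the number of subintervals, $\Delta t>0$ the length of a subinterval. $\mathbf{Q}\in\mathbb{R}^{M\times M}$ is the quadrature matrix ($\Delta t\,\mathbf{Q}_{ij}=\int_{t_l}^{\tau_i}\ell_j(s)\,ds$ with $\ell_j$ the Lagrange polynomials of the nodes $\tau_1<\cdots<\tau_M=t_{l+1}$ in $[t_l,t_{l+1}]$; the nodes have the same relative positions on every subinterval), and $\mathbf{Q}_\Delta\in\mathbb{R}^{M\times M}$ is a lower triangular matrix approximating $\mathbf{Q}$. $\mathbf{N}_M\in\mathbb{R}^{M\times M}$ has ones in its last column and zeros elsewhere. $\mathbf{E}\in\mathbb{R}^{L\times L}$ has ones on the first subdiagonal and zeros elsewhere. Fourier matrices: $\boldsymbol\Psi\in\mathbb{C}^{N\times N}$ is the unitary matrix with columns $\psi_k=\frac1{\sqrt N}\left(\exp(i\frac{2\pi}{N}kj)\right)_{j=0}^{N-1}$, $k=0,\ldots,N-1$; $\boldsymbol\Psi_C\in\mathbb{C}^{N/2\times N/2}$ is the analogous matrix for $N/2$ points. Spatial matrices: $A\in\mathbb{R}^{N\times N}$ and $\tilde A\in\mathbb{R}^{N/2\times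 N/2}$ are circulant (periodic problem; only space is coarsened, the same spatial operator is used on every subinterval), with eigenvalues $\lambda^{(A)}_j$ belonging to $\psi_j$ ($A\psi_j=\lambda_j^{(A)}\psi_j$), and $\lambda^{(\tilde A)}_j$ belonging to the $j$-th column of $\boldsymbol\Psi_C$. System matrix and preconditioners: $\mathbf{M}=\mathbf{I}_L\otimes\mathbf{I}_M\otimes\mathbf{I}_N-\Delta t\,\mathbf{I}_L\otimes\mathbf{Q}\otimes A-\mathbf{E}\otimes\mathbf{N}_M\otimes\mathbf{I}_N$, $\mathbf{P}=\mathbf{I}_L\otimes\mathbf{I}_M\otimes\mathbf{I}_N-\Delta t\,\mathbf{I}_L\otimes\mathbf{Q}_\Delta\otimes A-\mathbf{E}\otimes\mathbf{N}_M\otimes\mathbf{I}_N$, $\tilde{\mathbf{P}}=\mathbf{I}_L\otimes\mathbf{I}_M\otimes\mathbf{I}_{N/2}-\Delta t\,\mathbf{I}_L\otimes\mathbf{Q}_\Delta\otimes\tilde A-\mathbf{E}\otimes\mathbf{N}_M\otimes\mathbf{I}_{N/2}$. Transfer operators: for $X,Y\in\mathbb{R}^{n\times n}$ let $\mathcal{W}(X,Y)\in\mathbb{R}^{2n\times n}$ be the matrix whose rows are, in order, row 1 of $X$, row 1 of $Y$, row 2 of $X$, row 2 of $Y$, ..., row $n$ of $X$, row $n$ of $Y$. A CI-interpolation (circulant interweaved interpolation) is a matrix $\mathcal{W}(\mathbf{I}_{N/2},C)$ with $C\in\mathbb{R}^{N/2\times N/2}$ circulant and $C\mathbf{1}=\mathbf{1}$.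 A CI-restriction is a matrix $R\in\mathbb{R}^{N/2\times N}$ such that $c\,R^T$ is a CI-interpolation for some $c\in\mathbb{R}$. Here $\mathbf{T}_C^F=\mathbf{I}_L\otimes\mathbf{I}_M\otimes S$ with $S$ a CI-interpolation and $\mathbf{T}_F^C=\mathbf{I}_L\otimes\mathbf{I}_M\otimes R$ with $R$ a CI-restriction (possibly built from a different circulant matrix). The scalars $d_k,\hat d_k,f_k,\hat f_k$, $k=0,\ldots,N/2-1$, are the entries of the transformed operators $\boldsymbol\Psi^*S\boldsymbol\Psi_C=\begin{pmatrix}\mathrm{diag}(d_0,\ldots,d_{N/2-1})\\ \mathrm{diag}(\hat d_0,\ldots,\hat d_{N/2-1})\end{pmatrix}$ and $\boldsymbol\Psi_C^*R\boldsymbol\Psi=\begin{pmatrix}\mathrm{diag}(f_0,\ldots,f_{N/2-1})&\mathrm{diag}(\hat f_0,\ldots,\hat f_{N/2-1})\end{pmatrix}$ (both matrices have this form). *)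

(* Defs.v *)
(* The complex numbers are R[i] for R : realType; Kronecker products are *t, with
   the leftmost layer varying slowest. *)
From HB Require Import structures.
From mathcomp Require Import all_boot all_order all_algebra.
From mathcomp Require Import sesquilinear spectral.
From mathcomp Require Import complex mxtens.
From mathcomp Require Import all_classical all_reals all_analysis.

Set Implicit Arguments.
Unset Strict Implicit.
Unset Printing Implicit Defensive.

Import Order.TTheory GRing.Theory Num.Theory.
Import numFieldNormedType.Exports.

Local Open Scope classical_set_scope.
Local Open Scope ring_scope.
Local Open Scope complex_scope.
Local Open Scope sesquilinear_scope.

Section TimeDiscretization.
Variables (R : realType) (L M : nat).

(* Subinterval l is [t l, t l.+1], with nodes tau l 0 < ... < tau l (M - 1);
   the last one is the right end point. *)
Definition collocation_grid (dt : R) (t : nat -> R) (tau : 'I_L -> 'I_M -> R) :=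
  [/\ forall l : 'I_L, t l.+1 = t l + dt,
      forall (l : 'I_L) (i j : 'I_M), (i < j)%N -> tau l i < tau l j,
      forall (l : 'I_L) (i : 'I_M), t l <= tau l i <= t l.+1,
      forall (l : 'I_L) (i : 'I_M), i.+1 = M -> tau l i = t l.+1
    & forall (l l' : 'I_L) (i : 'I_M), tau l i - t l = tau l' i - t l'].

Definition lagrange_poly (x : 'I_M -> R) (j : 'I_M) : {poly R} :=
  \prod_(k < M | k != j) ((x j - x k)^-1 *: ('X - (x k)%:P)).

Definition is_quadrature_mx (dt : R) (t : nat -> R) (tau : 'I_L -> 'I_M -> R)
    (Q : 'M[R]_M) :=
  forall (l : 'I_L) (i j : 'I_M),
    dt * Q i j =
    \int[lebesgue_measure]_(s in `[t l, tau l i]) (lagrange_poly (tau l) j).[s].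

End TimeDiscretization.

Section SystemMatrices.
Variables (F : comNzRingType) (L M : nat).

Definition lastcol_mx : 'M[F]_M := \matrix_(i, j) (j.+1 == M)%:R.
Definition subdiag_mx : 'M[F]_L := \matrix_(i, j) (i == j.+1 :> nat)%:R.

(* With Q the quadrature matrix this is the composite collocation matrix; with
   Q replaced by its lower triangular approximation it is the preconditioner
   (the fine or the coarse one, according to A). *)
Definition system_mx (N : nat) (dt : F) (Q : 'M[F]_M) (A : 'M[F]_N) :
    'M[F]_(L * M * N) :=
  (1%:M : 'M[F]_L) *t (1%:M : 'M[F]_M) *t (1%:M : 'M[F]_N)
  - dt *: ((1%:M : 'M[F]_L) *t Q *t A)
  - subdiag_mx *t lastcol_mx *t (1%:M : 'M[F]_N).

Definition basic_block (dt : F) (Q : 'M[F]_M) (lambda : F) : 'M[F]_(L * M) :=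
  (1%:M : 'M[F]_L) *t (1%:M : 'M[F]_M) - subdiag_mx *t lastcol_mx
  - (lambda * dt) *: ((1%:M : 'M[F]_L) *t Q).

Definition space_lift (p q : nat) (X : 'M[F]_(p, q)) :
    'M[F]_(L * M * p, L * M * q) :=
  (1%:M : 'M[F]_L) *t (1%:M : 'M[F]_M) *t X.

End SystemMatrices.

Section Circulant.
Variables (R : realType) (n : nat).

Definition circulant (A : 'M[R]_n) :=
  exists c : nat -> R, forall i j : 'I_n, A i j = c ((i + n - j) %% n)%N.

Fact half_ord_subproof (i : 'I_(n + n)) : (i./2 < n)%N.
Proof. by rewrite ltn_half_double -addnn. Qed.
Definition half_ord (i : 'I_(n + n)) : 'I_n := Ordinal (half_ord_subproof i).

Definition interweave (X Y : 'M[R]_n) : 'M[R]_(n + n, n) :=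
  \matrix_(i, j) if odd i then Y (half_ord i) j else X (half_ord i) j.

Definition CI_interpolation (S : 'M[R]_(n + n, n)) :=
  exists C : 'M[R]_n,
    [/\ circulant C, C *m (const_mx 1 : 'cV_n) = const_mx 1
      & S = interweave 1%:M C].

Definition CI_restriction (S : 'M[R]_(n, n + n)) :=
  exists c : R, CI_interpolation (c *: S^T).

End Circulant.

Section Fourier.
Variable R : realType.

Definition expi (x : R) : R[i] := cos x +i* sin x.

Definition complex_mx p q (A : 'M[R]_(p, q)) : 'M[R[i]]_(p, q) :=
  map_mx (real_complex R) A.

Definition fourier_mx (N : nat) : 'M[R[i]]_N :=
  \matrix_(j, k) (((Num.sqrt N%:R)^-1)%:C * expi (2 * pi / N%:R * (k * j)%:R)).

Definition diagonalized_by_fourier N (A : 'M[R]_N) (lambda : 'I_N -> R[i]) :=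
  forall j : 'I_N, complex_mx A *m col j (fourier_mx N)
                   = lambda j *: col j (fourier_mx N).

Variable n : nat.

Definition interp_hat (S : 'M[R]_(n + n, n)) : 'M[R[i]]_(n + n, n) :=
  (fourier_mx (n + n)) ^t* *m complex_mx S *m fourier_mx n.

Definition restr_hat (S : 'M[R]_(n, n + n)) : 'M[R[i]]_(n, n + n) :=
  (fourier_mx n) ^t* *m complex_mx S *m fourier_mx (n + n).

(* For a CI-interpolation, interp_hat is two stacked diagonal matrices (restr_hat
   two juxtaposed ones, for a CI-restriction); these are their diagonal entries,
   belonging to the fine frequencies k (lo) and n + k (hi). *)
Definition interp_lo S (k : 'I_n) : R[i] := interp_hat S (lshift n k) k.
Definition interp_hi S (k : 'I_n) : R[i] := interp_hat S (rshift n k) k.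
Definition restr_lo S (k : 'I_n) : R[i] := restr_hat S k (lshift n k).
Definition restr_hi S (k : 'I_n) : R[i] := restr_hat S k (rshift n k).

End Fourier.

Section Reordering.
Variables (m N : nat).

(* Position u of the reordered index set, i.e. entry a of the N-layer's block j,
   is position (a, j) of the tensor product with the N-layer last. *)
Definition space_first (u : 'I_(\sum_(j < N) m)) : 'I_(m * N) :=
  mxtens_index (tagnat.sig2 u : 'I_m, tagnat.sig1 u).

Lemma space_first_bij : bijective space_first.
Proof.
exists (fun v : 'I_(m * N) => tagnat.Rank (p_ := fun _ : 'I_N => m)
          (mxtens_unindex v).2 (mxtens_unindex v).1) => [u|v].
  rewrite /space_first mxtens_indexK /=; exact: tagnat.sig2K.
rewrite /space_first -[RHS]mxtens_unindexK; congr mxtens_index.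
rewrite [RHS]surjective_pairing; congr pair; last exact: tagnat.Rank1K.
by apply: val_inj; rewrite /= tagnat.Rank2K.
Qed.

(* The matrix X with tensor layers (m, N) rewritten in the order (N, m). *)
Definition reorder_layers (T : Type) (X : 'M[T]_(m * N)) :
    'M[T]_(\sum_(j < N) m) :=
  mxsub space_first space_first X.

End Reordering.

Section Blocks.
Variables (R : realType) (L M n : nat).

Definition smoother_block (BP BM : 'I_(n + n) -> 'M[R[i]]_(L * M)) (k : 'I_n) :
    'M[R[i]]_(L * M + L * M) :=
  block_mx (1%:M - invmx (BP (lshift n k)) *m BM (lshift n k)) 0
           0 (1%:M - invmx (BP (rshift n k)) *m BM (rshift n k)).

Definition cgc_block (d dh f fh : 'I_n -> R[i])
    (BPt : 'I_n -> 'M[R[i]]_(L * M)) (BM : 'I_(n + n) -> 'M[R[i]]_(L * M))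
    (k : 'I_n) : 'M[R[i]]_(L * M + L * M) :=
  block_mx
    (1%:M - (f k * d k) *: (invmx (BPt k) *m BM (lshift n k)))
    (- ((fh k * d k) *: (invmx (BPt k) *m BM (rshift n k))))
    (- ((dh k * f k) *: (invmx (BPt k) *m BM (lshift n k))))
    (1%:M - (fh k * dh k) *: (invmx (BPt k) *m BM (rshift n k))).

Lemma sum_block_sizes : (\sum_(k < n) (L * M + L * M) = L * M * (n + n))%N.
Proof. by rewrite sum_nat_const card_ord !addnn -!muln2 mulnCA mulnA. Qed.

End Blocks.

(* Main.v *)
Require Import Defs.
From mathcomp Require Import all_boot all_order all_algebra.
From mathcomp Require Import sesquilinear spectral.
From mathcomp Require Import complex mxtens ring.
From mathcomp Require Import all_classical all_reals all_analysis.
Import Order.TTheory GRing.Theory Num.Theory.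
Local Open Scope ring_scope.
Local Open Scope complex_scope.
Local Open Scope sesquilinear_scope.
Set Implicit Arguments.
Unset Strict Implicit.

(**
   Every ingredient of the iteration except the transfer operators acts on
   space through I or through a circulant matrix, so the spatial Fourier basis
   W = I (x) I (x) Psi splits it into one LM x LM block per frequency:
   [system_mx_fourier] turns the system matrix and the preconditioners into
   [tens_diag] matrices, which multiply and invert blockwise.

   The transfer operators couple frequencies, but only in a mild way.  Sampling
   the fine modes k and n + k at the even grid points gives, up to a factor, the
   same coarse mode k (aliasing), and at the odd grid points the same again up
   to a phase.  An interweaved interpolation copies a coarse mode to the even
   points and, the circulant C having that mode as an eigenvector, a multiple of
   it to the odd points.  Hence it maps the coarse mode k into the span of the
   fine modes k and n + k ([interp_hat_eq0]).  A restriction is, up to a nonzero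
   real factor, the adjoint of an interpolation, so it has the transposed
   pattern ([restr_hat_eq0]).

   The 2LM coordinates that belong to a pair {k, n + k} of fine frequencies
   therefore span an invariant subspace of the iteration.  Reordering the
   Fourier coordinates pair by pair ([harmonic_pair]) makes the smoother and the
   coarse-grid correction block diagonal at the same time
   ([pair_tens_diag], [pair_coarse_operator]); the transformation asked for is W
   with its columns so reordered ([similar_reindex]).
*)

(** * Similarity and reindexing *)

Section SimilarMatrices.
Variable K : fieldType.

Lemma similar_unitmx p (W X : 'M[K]_p) :
  W \in unitmx -> X \in unitmx -> invmx W *m X *m W \in unitmx.
Proof. by move=> uW uX; rewrite !unitmx_mul unitmx_inv uW uX. Qed.

(** The change of basis of the coarse space is free: Wt and its inverse cancel
    on either side of the inverse of the coarse preconditioner. *)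
Lemma two_grid_similar p q (W P Mc : 'M[K]_p) (Wt Pt : 'M[K]_q)
    (S : 'M[K]_(p, q)) (Rs : 'M[K]_(q, p)) :
  W \in unitmx -> Wt \in unitmx -> P \in unitmx -> Pt \in unitmx ->
  let h X := invmx W *m X *m W in
  h ((1%:M - invmx P *m Mc) *m (1%:M - S *m invmx Pt *m Rs *m Mc)) =
  (1%:M - invmx (h P) *m h Mc) *m
  (1%:M - (invmx W *m S *m Wt) *m invmx (invmx Wt *m Pt *m Wt) *m
          (invmx Wt *m Rs *m W) *m h Mc).
Proof.
move=> uW uWt uP uPt h.
have hM X Y : h (X *m Y) = h X *m h Y by rewrite /h !mulmxA mulmxK.
have hB X : h (1%:M - X) = 1%:M - h X.
  by rewrite /h mulmxBr mulmxBl mulmx1 mulVmx.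
have invJ r (U X : 'M[K]_r) : U \in unitmx -> X \in unitmx ->
    invmx (invmx U *m X *m U) = invmx U *m invmx X *m U.
  move=> uU uX; have e : (invmx U *m invmx X *m U) *m (invmx U *m X *m U) = 1%:M.
    by rewrite !mulmxA mulmxK// mulmxKV// mulVmx.
  have [_ uJ] := mulmx1_unit e.
  by rewrite -[LHS]mul1mx -e mulmxK.
by rewrite hM !hB !hM /h !invJ// !mulmxA !mulmxK.
Qed.

End SimilarMatrices.

Section Reindexing.
Variable K : fieldType.

Lemma mxsub_mul_bij m n p q r (s : 'I_q -> 'I_p) (f : 'I_m -> 'I_n)
    (g : 'I_r -> 'I_n) (A : 'M[K]_(n, p)) (B : 'M[K]_(p, n)) :
  bijective s -> mxsub f g (A *m B) = mxsub f s A *m mxsub s g B.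
Proof.
move=> s_bij; apply/matrixP => i j; rewrite !mxE.
rewrite (reindex s) /=; last exact: onW_bij.
by apply: eq_bigr => k _; rewrite !mxE.
Qed.

Lemma mxsub1 p q (s : 'I_p -> 'I_q) :
  injective s -> mxsub s s (1%:M : 'M[K]_q) = 1%:M.
Proof. by move=> s_inj; apply/matrixP => i j; rewrite !mxE (inj_eq s_inj). Qed.

Lemma mxsub_unitmx p q (s : 'I_p -> 'I_q) (A : 'M[K]_q) :
  bijective s -> A \in unitmx -> mxsub s s A \in unitmx.
Proof.
move=> s_bij uA; have s_inj := bij_inj s_bij.
have: mxsub s s A *m mxsub s s (invmx A) = 1%:M.
  by rewrite -mxsub_mul_bij// mulmxV// mxsub1.
by case/mulmx1_unit.
Qed.

(** Renumbering the basis vectors in W is again a change of basis.  The two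
    index ranges have equal sizes only propositionally, hence the cast. *)
Lemma similar_reindex p q (e : p = q) (s : 'I_p -> 'I_q) (W X : 'M[K]_q) :
  bijective s -> W \in unitmx ->
  exists F, F \in unitmx /\
    invmx F *m X *m F = castmx (e, e) (mxsub s s (invmx W *m X *m W)).
Proof.
case: q / e s W X => s W X s_bij uW; rewrite castmx_id.
have VF : mxsub s id (invmx W) *m mxsub id s W = 1%:M.
  by rewrite -mxsub_mul mulVmx// mxsub1//; apply: bij_inj.
have [_ uF] := mulmx1_unit VF.
exists (mxsub id s W); split=> //.
have -> : invmx (mxsub id s W) = mxsub s id (invmx W).
  by rewrite -[LHS]mul1mx -VF mulmxK.
by rewrite mxsub_mul mxsub_mul mxsub_id.
Qed.

(** Multiplying by a right inverse Z of the whole matrix, the diagonal block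
    (i, i) of the product is B i times the block (i, i) of Z. *)
Lemma mxdiag_unitmx p (q_ : 'I_p -> nat) (B : forall i, 'M[K]_(q_ i)) i :
  \mxdiag_i B i \in unitmx -> B i \in unitmx.
Proof.
move=> uB; have := mulmxV uB; set Z := invmx _.
rewrite -[Z]submxblockK mul_mxdiag_mxblock => /(congr1 (fun X => submxblock X i i)).
rewrite mxblockK -mxdiagZ submxblock_diag.
by case/mulmx1_unit.
Qed.

Lemma mxdiagE N m (B : 'I_N -> 'M[K]_m) u v :
  (\mxdiag_j B j) u v =
  if tagnat.sig1 u == tagnat.sig1 v
  then B (tagnat.sig1 u) (tagnat.sig2 u) (tagnat.sig2 v) else 0.
Proof. by rewrite !mxE; case: eqP => _; rewrite ?mxE// conform_mx_id. Qed.

End Reindexing.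

(** * Matrices that are block diagonal in the frequency *)

Section FrequencyBlocks.
Variables (K : fieldType) (m N : nat).
Implicit Types B C : 'I_N -> 'M[K]_m.

(** The frequency is the last, fastest varying tensor layer, so these are
    block diagonal matrices only after [reorder_layers]; in the present order
    products come down to [tensmx_mul]. *)
Definition tens_diag B : 'M[K]_(m * N) := \sum_j B j *t delta_mx j j.

Lemma tens_diagE B a i b j :
  tens_diag B (mxtens_index (a, i)) (mxtens_index (b, j)) =
  if i == j then B i a b else 0.
Proof.
rewrite summxE (bigD1 i)//= big1 ?addr0 => [|k nki].
  by rewrite tensmxE mxE eqxx eq_sym /=; case: eqP; rewrite ?mulr1 ?mulr0.
by rewrite tensmxE mxE eq_sym (negbTE nki) mulr0.
Qed.

Lemma tens_diagP (X : 'M[K]_(m * N)) B :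
  (forall a i b j, X (mxtens_index (a, i)) (mxtens_index (b, j)) =
     if i == j then B i a b else 0) -> X = tens_diag B.
Proof.
move=> XE; apply/matrixP => u v.
by case: (mxtens_indexP u) => a i; case: (mxtens_indexP v) => b j; rewrite XE tens_diagE.
Qed.

Lemma tens_diag1 : tens_diag (fun=> 1%:M) = 1%:M.
Proof.
apply/esym/tens_diagP => a i b j.
rewrite mxE (can_eq (@mxtens_indexK _ _)) xpair_eqE andbC.
by case: eqP; rewrite // !mxE.
Qed.

Lemma tens_diagB B C : tens_diag B - tens_diag C = tens_diag (fun j => B j - C j).
Proof.
by apply: tens_diagP => a i b j; rewrite 2!mxE !tens_diagE; case: eqP; rewrite ?subr0 ?mxE.
Qed.

Lemma tens_diagM B C : tens_diag B *m tens_diag C = tens_diag (fun j => B j *m C j).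
Proof.
rewrite /tens_diag mulmx_suml; apply: eq_bigr => i _.
rewrite mulmx_sumr (bigD1 i)//= big1 ?addr0 => [|j nji].
  by rewrite tensmx_mul mul_delta_mx.
by rewrite tensmx_mul mul_delta_mx_0 1?eq_sym// tensmx0.
Qed.

Lemma reorder_tens_diag B : reorder_layers (tens_diag B) = \mxdiag_j B j.
Proof. by apply/matrixP => u v; rewrite mxE tens_diagE mxdiagE. Qed.

Lemma tens_diag_unitmx B j : tens_diag B \in unitmx -> B j \in unitmx.
Proof.
move=> uB; apply: (mxdiag_unitmx (B := B)).
by rewrite -reorder_tens_diag mxsub_unitmx//; apply: space_first_bij.
Qed.

Lemma invmx_tens_diag B :
  tens_diag B \in unitmx -> invmx (tens_diag B) = tens_diag (fun j => invmx (B j)).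
Proof.
move=> uB; rewrite -[RHS](mulKmx uB) tens_diagM.
have -> : tens_diag (fun j => B j *m invmx (B j)) = 1%:M.
  rewrite -tens_diag1; congr tens_diag; apply/funext => j.
  by rewrite mulmxV ?tens_diag_unitmx.
by rewrite mulmx1.
Qed.

Lemma mul_mxdiag_mxdiag B C :
  \mxdiag_j B j *m \mxdiag_j C j = \mxdiag_j (B j *m C j).
Proof.
rewrite -!reorder_tens_diag -tens_diagM /reorder_layers.
by rewrite (mxsub_mul_bij _ _ _ _ (space_first_bij m N)).
Qed.

End FrequencyBlocks.

(** * Pairing the frequencies k and n + k *)

Section FrequencyPairs.
Variables (K : fieldType) (m n : nat).

(** Coordinate a of the first (second) half of block k goes to coordinate a of
    the frequency k (n + k), the two fine frequencies that alias to k. *)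
Definition harmonic_pair (u : 'I_(\sum_(k < n) (m + m))) : 'I_(m * (n + n)) :=
  match fintype.split (tagnat.sig2 u : 'I_(m + m)) with
  | inl a => mxtens_index (a, lshift n (tagnat.sig1 u))
  | inr a => mxtens_index (a, rshift n (tagnat.sig1 u))
  end.

Lemma harmonic_pair_bij : bijective harmonic_pair.
Proof.
apply: inj_card_bij; last first.
  by rewrite !card_ord sum_nat_const card_ord !addnn -!muln2 mulnCA mulnA.
move=> u v; rewrite /harmonic_pair => uv.
suff [e1 e2] : tagnat.sig1 u = tagnat.sig1 v /\
               (tagnat.sig2 u : 'I_(m + m)) = tagnat.sig2 v.
  rewrite -[u]tagnat.sig2K -[v]tagnat.sig2K.
  by move: (tagnat.sig2 u) (tagnat.sig2 v) e2; rewrite e1 => ? ? /= ->.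
move: uv (splitK (tagnat.sig2 u : 'I_(m + m))) (splitK (tagnat.sig2 v : 'I_(m + m))).
case: (fintype.split _) => a; case: (fintype.split _) => b /=
  /(can_inj (@mxtens_indexK _ _)) [] -> + <- <-.
- by move=> /val_inj ->.
- by move=> E; have := ltn_ord (tagnat.sig1 u); rewrite E ltnNge leq_addr.
- by move=> E; have := ltn_ord (tagnat.sig1 v); rewrite -E ltnNge leq_addr.
- by move=> /addnI/val_inj ->.
Qed.

Lemma mxsub_pairP (X : 'M[K]_(m * (n + n))) (B : 'I_n -> 'M[K]_(m + m)) :
  (forall a b i j,
     X (mxtens_index (a, lshift n i)) (mxtens_index (b, lshift n j)) =
       (if i == j then B i (lshift m a) (lshift m b) else 0) /\
     X (mxtens_index (a, lshift n i)) (mxtens_index (b, rshift n j)) =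
       (if i == j then B i (lshift m a) (rshift m b) else 0) /\
     X (mxtens_index (a, rshift n i)) (mxtens_index (b, lshift n j)) =
       (if i == j then B i (rshift m a) (lshift m b) else 0) /\
     X (mxtens_index (a, rshift n i)) (mxtens_index (b, rshift n j)) =
       (if i == j then B i (rshift m a) (rshift m b) else 0)) ->
  mxsub harmonic_pair harmonic_pair X = \mxdiag_k B k.
Proof.
move=> XE; apply/matrixP => u v; rewrite mxE mxdiagE /harmonic_pair.
rewrite -(splitK (tagnat.sig2 u : 'I_(m + m))) -(splitK (tagnat.sig2 v : 'I_(m + m))).
rewrite !unsplitK.
case: (fintype.split _) => a; case: (fintype.split _) => b /=;
by have [? [? [? ?]]] := XE a b (tagnat.sig1 u) (tagnat.sig1 v).
Qed.

Lemma pair_tens_diag (B : 'I_(n + n) -> 'M[K]_m) :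
  mxsub harmonic_pair harmonic_pair (tens_diag B) =
  \mxdiag_k block_mx (B (lshift n k)) 0 0 (B (rshift n k)).
Proof.
apply: mxsub_pairP => a b i j; rewrite !tens_diagE.
rewrite block_mxEul block_mxEur block_mxEdl block_mxEdr !mxE.
by rewrite eq_lshift eq_rshift eq_lrshift eq_rlshift if_same.
Qed.

(** The coarse frequency k is the only link between fine frequencies, and it is
    reached from, and reaches, only k and n + k; the block belonging to k is thus
    C k weighted by the entries of the rank-one matrix formed by column k of S
    and row k of R. *)
Lemma pair_coarse_operator (S : 'M[K]_(n + n, n)) (R : 'M[K]_(n, n + n))
    (C : 'I_n -> 'M[K]_m) :
  (forall i k, i != k -> S (lshift n i) k = 0 /\ S (rshift n i) k = 0) ->
  (forall i k, i != k -> R k (lshift n i) = 0 /\ R k (rshift n i) = 0) ->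
  mxsub harmonic_pair harmonic_pair
    ((1%:M *t S) *m tens_diag C *m (1%:M *t R)) =
  \mxdiag_k block_mx
    ((R k (lshift n k) * S (lshift n k) k) *: C k)
    ((R k (rshift n k) * S (lshift n k) k) *: C k)
    ((S (rshift n k) k * R k (lshift n k)) *: C k)
    ((R k (rshift n k) * S (rshift n k) k) *: C k).
Proof.
move=> S0 R0; rewrite /tens_diag mulmx_sumr mulmx_suml.
have E (a b : 'I_m) (i j : 'I_(n + n)) :
    (\sum_k (1%:M *t S) *m (C k *t delta_mx k k) *m (1%:M *t R))
      (mxtens_index (a, i)) (mxtens_index (b, j)) =
    \sum_k S i k * R k j * C k a b.
  rewrite summxE; apply: eq_bigr => k _.
  rewrite !tensmx_mul mul1mx mulmx1 tensmxE mulrC; congr (_ * _).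
  (* S * delta_kk * R is column k of S times row k of R. *)
  rewrite -(mul_delta_mx (0 : 'I_1)) mulmxA -mulmxA -colE -rowE mxE big_ord1.
  by rewrite !mxE.
apply: mxsub_pairP => a b i j; rewrite !E.
rewrite block_mxEul block_mxEur block_mxEdl block_mxEdr ![in RHS]mxE.
(* Only k = i is seen by the rows i and n + i of S, and only k = j by the columns
   j and n + j of R. *)
have D (x y : 'I_n -> K) z : (forall k, i != k -> x k = 0) ->
    (forall k, j != k -> y k = 0) -> (i = j -> x i * y i = z) ->
    \sum_k x k * y k * C k a b = if i == j then z * C i a b else 0.
  move=> x0 y0 xyz; rewrite (bigD1 i)//= big1 ?addr0 => [|k]; last first.
    by rewrite eq_sym => /x0 ->; rewrite !mul0r.
  have [/xyz -> //|] := eqVneq i j.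
  by rewrite eq_sym => /y0 ->; rewrite mulr0 mul0r.
split; [|split; [|split]]; rewrite ?[in RHS]mxE; apply: D => [k ik|k jk|->].
all: try by [have [] := S0 _ _ ik|have [] := R0 _ _ jk].
all: by rewrite // mulrC.
Qed.

Lemma sub_block_mul_diag (a b c d : K) (X Y Z : 'M[K]_m) :
  1%:M - block_mx (a *: X) (b *: X) (c *: X) (d *: X) *m block_mx Y 0 0 Z =
  block_mx (1%:M - a *: (X *m Y)) (- (b *: (X *m Z)))
           (- (c *: (X *m Y))) (1%:M - d *: (X *m Z)).
Proof.
rewrite mulmx_block !mulmx0 !addr0 !add0r -!scalemxAl scalar_mx_block.
by rewrite opp_block_mx add_block_mx !add0r.
Qed.

End FrequencyPairs.

(** * Space-time matrices and a change of the spatial basis *)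

Section SpaceLift.
Variables (F : comNzRingType) (L M : nat).

Lemma tensmx1 m n : (1%:M : 'M[F]_m) *t (1%:M : 'M[F]_n) = 1%:M.
Proof.
apply/matrixP => u v.
case: (mxtens_indexP u) => a i; case: (mxtens_indexP v) => b j.
by rewrite tensmxE !mxE (can_eq (@mxtens_indexK _ _)) xpair_eqE -natrM mulnb.
Qed.

Lemma space_liftM p q r (X : 'M[F]_(p, q)) (Y : 'M[F]_(q, r)) :
  space_lift L M (X *m Y) = space_lift L M X *m space_lift L M Y.
Proof. by rewrite /space_lift tensmx_mul tensmx1 mulmx1. Qed.

Lemma space_lift1 p : space_lift L M (1%:M : 'M[F]_p) = 1%:M.
Proof. by rewrite /space_lift !tensmx1. Qed.

Lemma space_liftE p q (X : 'M[F]_(p, q)) :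
  space_lift L M X = (1%:M : 'M[F]_(L * M)) *t X.
Proof. by rewrite /space_lift tensmx1. Qed.

Lemma system_mx_conj p (dt : F) (Q : 'M[F]_M) (A U V : 'M[F]_p) :
  V *m U = 1%:M ->
  space_lift L M V *m system_mx L dt Q A *m space_lift L M U =
  system_mx L dt Q (V *m A *m U).
Proof.
move=> VU; rewrite /system_mx /space_lift !mulmxBr !mulmxBl -scalemxAr -scalemxAl.
by rewrite !tensmx_mul !mul1mx !mulmx1 VU.
Qed.

End SpaceLift.

Lemma system_mx_diag (K : fieldType) L M p (dt : K) (Q : 'M[K]_M) (lam : 'I_p -> K) :
  system_mx L dt Q (diag_mx (\row_j lam j)) =
  tens_diag (fun j => basic_block L dt Q (lam j)).
Proof.
apply: tens_diagP => a i b j.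
rewrite /system_mx /basic_block.
set T1 := 1%:M *t 1%:M; set T2 := 1%:M *t Q; set T3 := _ *t lastcol_mx _ _.
move: T1 T2 T3 => T1 T2 T3.
rewrite !mxE !mxtens_indexK /=; case: eqP => [->|_].
  by rewrite !mulr1 mulr1n addrAC mulrA mulrAC -mulrA mulrCA mulrA.
by rewrite mulr0n !mulr0 subrr subr0.
Qed.

Lemma map_system_mx (F G : comNzRingType) (f : {rmorphism F -> G}) L M p (dt : F)
    (Q : 'M[F]_M) (A : 'M[F]_p) :
  map_mx f (system_mx L dt Q A) = system_mx L (f dt) (map_mx f Q) (map_mx f A).
Proof.
have fE : map_mx f (subdiag_mx F L) = subdiag_mx G L.
  by apply/matrixP => i j; rewrite !mxE; apply: rmorph_nat.
have fN : map_mx f (lastcol_mx F M) = lastcol_mx G M.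
  by apply/matrixP => i j; rewrite !mxE; apply: rmorph_nat.
by rewrite /system_mx !map_mxB map_mxZ !map_mxT !map_mx1 fE fN.
Qed.

Lemma map_space_lift (F G : comNzRingType) (f : {rmorphism F -> G}) L M p q
    (X : 'M[F]_(p, q)) :
  map_mx f (space_lift L M X) = space_lift L M (map_mx f X).
Proof. by rewrite /space_lift !map_mxT !map_mx1. Qed.

(** * The discrete Fourier basis *)

Section RootOfUnity.
Variable R : realType.
Implicit Types (x : R) (N : nat).

Lemma expi0 : expi (0 : R) = 1.
Proof. by rewrite /expi cos0 sin0. Qed.

Lemma expiD x y : expi (x + y) = expi x * expi y.
Proof. by rewrite /expi cosD sinD [RHS]/GRing.mul/= [in X in _ +i* X]addrC. Qed.

Lemma expiX x k : expi (x * k%:R) = expi x ^+ k.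
Proof.
elim: k => [|k IH]; first by rewrite mulr0 expi0.
by rewrite exprSr -IH -natr1 mulrDr mulr1 expiD.
Qed.

Lemma expiNK x : expi x * expi (- x) = 1.
Proof. by rewrite -expiD subrr expi0. Qed.

Lemma expi_neq0 x : expi x != 0.
Proof. by apply: contra_eq_neq (expiNK x) => ->; rewrite mul0r eq_sym oner_eq0. Qed.

Lemma conj_expi x : Num.conj (expi x) = (expi x)^-1.
Proof.
have -> : Num.conj (expi x) = expi (- x) by rewrite /expi cosN sinN.
by rewrite -[LHS](mulKf (expi_neq0 x)) expiNK mulr1.
Qed.

(** If cos x = 1 then sin (x / 2) = 0 by the half-angle formula, while
    x / 2 lies in (0, pi). *)
Lemma expi_neq1 x : 0 < x < 2 * pi -> expi x != 1.
Proof.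
move=> /andP[x0 x2]; apply/eqP => -[cx _].
have xh : x = (x / 2) + (x / 2) by rewrite -splitr.
have s0 : 0 < sin (x / 2).
  by apply: sin_gt0_pi; rewrite ?divr_gt0// ltr_pdivrMr// mulrC.
move: cx; rewrite {1}xh cosD -!expr2 => cx.
have := cos2Dsin2 (x / 2); rewrite -[RHS]cx => /addrI/eqP.
by rewrite eq_sym eqNr sqrf_eq0 gt_eqF.
Qed.

Definition omega N : R[i] := expi (2 * pi / N%:R).

Lemma omegaXN N : (0 < N)%N -> omega N ^+ N = 1.
Proof.
move=> N0; rewrite -expiX mulfVK ?pnatr_eq0 -?lt0n//.
by rewrite mulr_natl /expi cos2pi -[pi *+ 2]add0r sinD2pi sin0.
Qed.

Lemma omega_neq1 N k : (0 < k < N)%N -> omega N ^+ k != 1.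
Proof.
move=> /andP[k0 kN]; rewrite -expiX; apply: expi_neq1.
have N0 := ltn_trans k0 kN.
rewrite !mulr_gt0 ?pi_gt0 ?invr_gt0 ?ltr0n//= mulrAC ltr_pdivrMr ?ltr0n//.
by rewrite ltr_pM2l ?mulr_gt0 ?pi_gt0// ltr_nat.
Qed.

Lemma omega_prim N : (0 < N)%N -> N.-primitive_root (omega N).
Proof.
move=> N0; apply/andP; split=> //; apply/forallP => k.
rewrite unity_rootE; apply/eqP.
have [->|kN] := eqVneq k.+1 N; first by rewrite omegaXN ?eqxx.
by apply/negbTE/omega_neq1 => /=; rewrite ltn_neqAle kN ltn_ord.
Qed.

Lemma conj_omega N k : Num.conj (omega N ^+ k) = (omega N ^+ k)^-1.
Proof. by rewrite -expiX conj_expi. Qed.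

(** A geometric sum with ratio omega ^ (l - k), an N-th root of unity different
    from 1. *)
Lemma sum_omega N (k l : nat) : (0 < N)%N -> ~~ (k == l %[mod N]) ->
  \sum_(j < N) Num.conj (omega N ^+ (k * j)) * omega N ^+ (l * j) = 0.
Proof.
move=> N0 kl; set z := omega N ^+ l / omega N ^+ k.
have u0 : omega N != 0 by apply: expi_neq0.
have zN : z ^+ N = 1.
  by rewrite expr_div_n -!exprM ![(_ * N)%N]mulnC !exprM omegaXN// !expr1n divr1.
have z1 : z != 1.
  apply: contra kl => /eqP/divr1_eq/eqP.
  by rewrite (eq_prim_root_expr (omega_prim N0)) eq_sym.
rewrite (eq_bigr (fun j : 'I_N => z ^+ j)) => [|j _]; last first.
  by rewrite conj_omega mulrC expr_div_n -!exprM.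
by apply: (mulfI (x := z - 1)); rewrite ?subr_eq0// -subrX1 zN subrr mulr0.
Qed.

Definition fourier_scale N : R[i] := ((Num.sqrt N%:R)^-1)%:C.

Lemma conj_fourier_scale N : Num.conj (fourier_scale N) = fourier_scale N.
Proof. exact: conjc_real. Qed.

Lemma fourier_scale_sqr N : (0 < N)%N -> fourier_scale N * fourier_scale N * N%:R = 1.
Proof.
move=> N0; rewrite -rmorphM -(rmorph_nat (real_complex R)) -rmorphM /=.
by rewrite -invfM -expr2 sqr_sqrtr ?ler0n// mulVf ?rmorph1// pnatr_eq0 -lt0n.
Qed.

Lemma fourier_mxE N j k : fourier_mx R N j k = fourier_scale N * omega N ^+ (k * j).
Proof. by rewrite mxE expiX. Qed.

Lemma conj_fourier_mxE N j k :
  ((fourier_mx R N)^t* ) k j = fourier_scale N * Num.conj (omega N ^+ (k * j)).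
Proof. by rewrite !mxE expiX rmorphM; congr (_ * _); apply: conj_fourier_scale. Qed.

Lemma fourier_mx_unitary N : (0 < N)%N ->
  (fourier_mx R N)^t* *m fourier_mx R N = 1%:M.
Proof.
move=> N0; apply/matrixP => k l; rewrite [LHS]mxE.
under eq_bigr do rewrite conj_fourier_mxE fourier_mxE mulrACA.
rewrite -mulr_sumr mxE; have [<-|kl] := eqVneq k l.
  rewrite -[RHS](fourier_scale_sqr N0); congr (_ * _).
  rewrite -[N in RHS]card_ord -sum1_card natr_sum; apply: eq_bigr => j _.
  by rewrite conj_omega mulVf// expf_neq0// expi_neq0.
by rewrite sum_omega ?mulr0// !modn_small.
Qed.

(** Circulant matrices are convolutions, so they multiply each Fourier mode by
    a transform of their first column. *)
Lemma circulant_diagonalized n (C : 'M[R]_n) :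
  circulant C -> exists mu, diagonalized_by_fourier C mu.
Proof.
case=> c Cc.
exists (fun k => \sum_(d < n) (c d)%:C * (omega n ^+ (k * d))^-1) => k.
apply/matrixP => i z; rewrite [LHS]mxE [RHS]mxE [in RHS]mxE.
have n0 : (0 < n)%N by apply: leq_ltn_trans (ltn_ord i).
(* The substitution d = i - l mod n, a reflection. *)
pose r (l : 'I_n) : 'I_n := Ordinal (ltn_pmod (i + n - l) n0).
have rK : involutive r.
  move=> l; apply: val_inj => /=.
  have li := ltnW (ltn_ord l).
  have le : (l <= i + n)%N by apply: leq_trans (leq_addl _ _).
  have le' : ((i + n - l) %% n <= i + n)%N.
    by apply: leq_trans (leq_mod _ _) (leq_subr _ _).
  rewrite -[RHS](modn_small (ltn_ord l)); apply/eqP.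
  by rewrite -(eqn_modDr ((i + n - l) %% n)) subnK// modnDmr subnKC.
rewrite (reindex_inj (inv_inj rK)) mulr_suml; apply: eq_bigr => d _ /=.
rewrite mxE Cc mxE fourier_mxE fourier_mxE mulrCA [RHS]mulrCA -mulrA; congr (_ * _).
have -> : ((i + n - r d) %% n = d)%N by rewrite -[in RHS](rK d).
congr (_ * _); apply: (mulfI (x := omega n ^+ (k * d))).
  by rewrite expf_neq0// expi_neq0.
rewrite mulVKf ?expf_neq0 ?expi_neq0// -exprD -mulnDr.
apply/eqP; rewrite (eq_prim_root_expr (omega_prim n0)) -modnMmr modnDmr.
rewrite subnKC ?modnDr ?modnMmr//.
by apply: leq_trans (leq_addl _ _); apply/ltnW.
Qed.

End RootOfUnity.

(** * Aliasing in the transfer operators *)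

Section EvenOdd.
Variable n : nat.

Fact even_ord_subproof (j : 'I_n) : (j.*2 < n + n)%N.
Proof. by rewrite addnn ltn_double. Qed.
Definition even_ord j := Ordinal (even_ord_subproof j).

Fact odd_ord_subproof (j : 'I_n) : (j.*2.+1 < n + n)%N.
Proof. by rewrite addnn ltn_Sdouble. Qed.
Definition odd_ord j := Ordinal (odd_ord_subproof j).

Lemma half_even_ord j : half_ord (even_ord j) = j.
Proof. by apply: val_inj; rewrite /= doubleK. Qed.

Lemma half_odd_ord j : half_ord (odd_ord j) = j.
Proof. by apply: val_inj; rewrite /= uphalf_double. Qed.

Lemma sum_even_odd (V : nmodType) (G : 'I_(n + n) -> V) :
  \sum_i G i = \sum_j (G (even_ord j) + G (odd_ord j)).
Proof.
rewrite big_split /= (bigID (fun i : 'I_(n + n) => odd i)) /= addrC.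
congr (_ + _).
  rewrite (reindex_onto even_ord (@half_ord n)) => [|i /negbTE oi].
    by apply: eq_bigl => j; rewrite half_even_ord eqxx /= odd_double.
  by apply: val_inj; rewrite /= -[RHS]odd_double_half oi.
rewrite (reindex_onto odd_ord (@half_ord n)) => [|i oi].
  by apply: eq_bigl => j; rewrite half_odd_ord eqxx /= odd_double.
by apply: val_inj; rewrite /= -[RHS]odd_double_half oi.
Qed.

End EvenOdd.

Section Aliasing.
Variables (R : realType) (n : nat).

(** On every other fine point the fine modes run through the coarse root of
    unity, which makes them coarse modes. *)
Lemma omega_double : omega R (n + n) ^+ 2 = omega R n.
Proof.
rewrite /omega -expiX; congr expi.
by rewrite addnn -muln2 natrM invfM mulrA divfK ?pnatr_eq0.
Qed.

(** The inner product of the fine mode i with an interpolated coarse mode k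
    splits into even and odd points; both parts are multiples of the inner
    product of the coarse modes i mod n and k. *)
Lemma interp_hat_eq0 (S : 'M[R]_(n + n, n)) (i : 'I_(n + n)) (k : 'I_n) :
  CI_interpolation S -> ~~ (i == k %[mod n]) -> interp_hat S i k = 0.
Proof.
case=> C [/circulant_diagonalized[mu Cmu] _ ->] ik.
have n0 : (0 < n)%N := leq_ltn_trans (leq0n _) (ltn_ord k).
have evenE j : (complex_mx (interweave 1%:M C) *m fourier_mx R n) (even_ord j) k =
    fourier_mx R n j k.
  rewrite mxE (bigD1 j)//= big1 ?addr0 => [|l nlj].
    by rewrite !mxE /= odd_double half_even_ord eqxx mul1r.
  by rewrite !mxE /= odd_double half_even_ord eq_sym (negbTE nlj) mul0r.
have oddE j : (complex_mx (interweave 1%:M C) *m fourier_mx R n) (odd_ord j) k =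
    mu k * fourier_mx R n j k.
  have /matrixP/(_ j 0) := Cmu k; rewrite mxE [RHS]mxE [in RHS]mxE => <-.
  rewrite mxE; apply: eq_bigr => l _.
  by rewrite !mxE /= odd_double half_odd_ord.
rewrite /interp_hat -mulmxA mxE sum_even_odd.
(* The even points contribute the term 1; the odd ones the eigenvalue of C times
   the phase by which mode i advances over one fine step. *)
transitivity (\sum_(j < n) (fourier_scale R (n + n) * fourier_scale R n *
    (1 + Num.conj (omega R (n + n) ^+ i) * mu k) *
    (Num.conj (omega R n ^+ (i * j)) * omega R n ^+ (k * j)))); last first.
  by rewrite -mulr_sumr sum_omega ?mulr0.
apply: eq_bigr => j _; rewrite evenE oddE !conj_fourier_mxE fourier_mxE /=.
rewrite mulnS exprD -mul2n mulnCA exprM omega_double rmorphM /=.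
ring.
Qed.

Lemma trmxC_complex_mx p q (X : 'M[R]_(p, q)) :
  (complex_mx X)^t* = complex_mx X^T.
Proof. by apply/matrixP => a b; rewrite !mxE; apply: conjc_real. Qed.

(** By duality with [interp_hat_eq0]: the transform of the transpose is the
    adjoint of the transform. *)
Lemma restr_hat_eq0 (S : 'M[R]_(n, n + n)) (i : 'I_(n + n)) (k : 'I_n) :
  CI_restriction S -> ~~ (i == k %[mod n]) -> restr_hat S k i = 0.
Proof.
case=> c cS ik.
have c0 : c != 0.
  (* The identity rows of an interweaved interpolation do not vanish. *)
  case: cS => C [_ _ /matrixP/(_ (even_ord k) k)].
  rewrite !mxE /= odd_double half_even_ord eqxx => cS.
  by apply: contra_eq_neq cS => ->; rewrite mul0r eq_sym oner_eq0.
have := interp_hat_eq0 cS ik.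
have -> : interp_hat (c *: S^T) = c%:C *: (restr_hat S)^t*.
  rewrite /interp_hat /restr_hat [complex_mx (_ *: _)]map_mxZ.
  rewrite -scalemxAr -scalemxAl -/(complex_mx S^T) -trmxC_complex_mx.
  by rewrite trmx_mul map_mxM trmx_mul map_mxM trmxCK mulmxA.
rewrite !mxE => /eqP; rewrite mulf_eq0 conjC_eq0 => /orP[|/eqP//].
by rewrite (fmorph_eq0 (real_complex R)) (negbTE c0).
Qed.

Lemma alias_neq_mod (i k : 'I_n) : i != k ->
  ~~ (lshift n i == k %[mod n]) /\ ~~ (rshift n i == k %[mod n]).
Proof. by move=> ik; split; rewrite /= ?modnDl !modn_small. Qed.

End Aliasing.

(** * Block diagonalization of the two-grid iteration *)

Section FourierSimilarity.
Variables (R : realType) (L M : nat).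

Lemma diagonalized_by_fourierE N (A : 'M[R]_N) lam : (0 < N)%N ->
  diagonalized_by_fourier A lam ->
  (fourier_mx R N)^t* *m complex_mx A *m fourier_mx R N = diag_mx (\row_j lam j).
Proof.
move=> N0 eigA; rewrite -mulmxA.
have -> : complex_mx A *m fourier_mx R N = fourier_mx R N *m diag_mx (\row_j lam j).
  apply/matrixP => i j.
  transitivity ((complex_mx A *m col j (fourier_mx R N)) i 0).
    by rewrite !mxE; apply: eq_bigr => k _; rewrite !mxE.
  by rewrite eigA mul_mx_diag !mxE mulrC.
by rewrite mulmxA fourier_mx_unitary// mul1mx.
Qed.

Lemma space_fourier_unitmx N : (0 < N)%N ->
  space_lift L M (fourier_mx R N) \in unitmx /\
  invmx (space_lift L M (fourier_mx R N)) = space_lift L M ((fourier_mx R N)^t* ).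
Proof.
move=> N0.
have VW : space_lift L M ((fourier_mx R N)^t* ) *m space_lift L M (fourier_mx R N) = 1%:M.
  by rewrite -space_liftM fourier_mx_unitary// space_lift1.
have [_ uW] := mulmx1_unit VW; split=> //.
by rewrite -[LHS]mul1mx -VW mulmxK.
Qed.

Lemma system_mx_fourier N (dt : R) (Q : 'M[R]_M) (A : 'M[R]_N) lam : (0 < N)%N ->
  diagonalized_by_fourier A lam ->
  let W := space_lift L M (fourier_mx R N) in
  invmx W *m complex_mx (system_mx L dt Q A) *m W =
  tens_diag (fun j => basic_block L dt%:C (complex_mx Q) (lam j)).
Proof.
move=> N0 eigA W; have [uW ->] := space_fourier_unitmx N0.
rewrite /complex_mx map_system_mx system_mx_conj ?fourier_mx_unitary//.
by rewrite (diagonalized_by_fourierE N0 eigA) system_mx_diag.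
Qed.

End FourierSimilarity.

(** The purely algebraic part: W and Wt may be any bases in which the operators
    are blockwise diagonal in the frequency and the transfer operators have the
    aliasing pattern. *)
Lemma two_grid_block_diagonalization (R : realType) (L M n : nat)
    (W P Mc : 'M[R[i]]_(L * M * (n + n))) (Wt Pt : 'M[R[i]]_(L * M * n))
    (TCF : 'M[R[i]]_(L * M * (n + n), L * M * n))
    (TFC : 'M[R[i]]_(L * M * n, L * M * (n + n)))
    (Sh : 'M[R[i]]_(n + n, n)) (Rh : 'M[R[i]]_(n, n + n))
    (BP BM : 'I_(n + n) -> 'M[R[i]]_(L * M)) (BPt : 'I_n -> 'M[R[i]]_(L * M)) :
  W \in unitmx -> Wt \in unitmx -> P \in unitmx -> Pt \in unitmx ->
  invmx W *m P *m W = tens_diag BP ->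
  invmx W *m Mc *m W = tens_diag BM ->
  invmx Wt *m Pt *m Wt = tens_diag BPt ->
  invmx W *m TCF *m Wt = 1%:M *t Sh ->
  invmx Wt *m TFC *m W = 1%:M *t Rh ->
  (forall i k, i != k -> Sh (lshift n i) k = 0 /\ Sh (rshift n i) k = 0) ->
  (forall i k, i != k -> Rh k (lshift n i) = 0 /\ Rh k (rshift n i) = 0) ->
  exists F, F \in unitmx /\
    invmx F *m ((1%:M - invmx P *m Mc) *m
                (1%:M - TCF *m invmx Pt *m TFC *m Mc)) *m F =
    castmx (sum_block_sizes L M n, sum_block_sizes L M n)
      (\mxdiag_(k < n)
         (smoother_block BP BM k *m
          cgc_block (fun k => Sh (lshift n k) k) (fun k => Sh (rshift n k) k)
                    (fun k => Rh k (lshift n k)) (fun k => Rh k (rshift n k))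
                    BPt BM k)).
Proof.
move=> uW uWt uP uPt hP hM hPt hS hR S0 R0.
have uBP : tens_diag BP \in unitmx by rewrite -hP similar_unitmx.
have uBPt : tens_diag BPt \in unitmx by rewrite -hPt similar_unitmx.
have pbij := @harmonic_pair_bij (L * M) n.
set T := _ *m (_ - _ *m Mc).
have [F [uF FT]] := similar_reindex (sum_block_sizes L M n) T pbij uW.
exists F; split=> //; rewrite FT; congr castmx.
rewrite (two_grid_similar _ _ _ uW uWt uP uPt) hP hM hPt hS hR.
rewrite !invmx_tens_diag// tens_diagM -[X in X - tens_diag _]tens_diag1 tens_diagB.
rewrite (mxsub_mul_bij _ _ _ _ pbij) pair_tens_diag linearB/=.
rewrite (mxsub_mul_bij _ _ _ _ pbij) pair_tens_diag pair_coarse_operator//.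
rewrite mxsub1; last exact: bij_inj.
rewrite -(mxdiagZ (p_ := fun _ : 'I_n => (L * M + L * M)%N)).
rewrite mul_mxdiag_mxdiag -mxdiagB mul_mxdiag_mxdiag.
apply: eq_mxdiag => k; congr (_ *m _).
exact: sub_block_mul_diag.
Qed.

Unset Implicit Arguments.
Set Strict Implicit.

Theorem theorem2 (R : realType) (L M n : nat)
  (L_gt0 : (0 < L)%N) (M_gt0 : (0 < M)%N) (n_gt0 : (0 < n)%N)
  (dt : R) (dt_gt0 : 0 < dt)
  (t : nat -> R) (tau : 'I_L -> 'I_M -> R)
  (grid : collocation_grid dt t tau)
  (Q QD : 'M[R]_M) (quadQ : is_quadrature_mx dt t tau Q)
  (trigQD : is_trig_mx QD)
  (A : 'M[R]_(n + n)) (At : 'M[R]_n)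
  (circA : circulant A) (circAt : circulant At)
  (lamA : 'I_(n + n) -> R[i]) (lamAt : 'I_n -> R[i])
  (eigA : diagonalized_by_fourier A lamA)
  (eigAt : diagonalized_by_fourier At lamAt)
  (S : 'M[R]_(n + n, n)) (Rs : 'M[R]_(n, n + n))
  (interpS : CI_interpolation S) (restrRs : CI_restriction Rs)
  (unitP : system_mx L dt QD A \in unitmx)
  (unitPt : system_mx L dt QD At \in unitmx) :
  let Mc := system_mx L dt Q A in
  let P := system_mx L dt QD A in
  let Pt := system_mx L dt QD At in
  let TCF := space_lift L M S in
  let TFC := space_lift L M Rs in
  let T : 'M[R]_(L * M * (n + n)) :=
    (1%:M - invmx P *m Mc) *m (1%:M - TCF *m invmx Pt *m TFC *m Mc) in
  let BP j := basic_block L dt%:C (complex_mx QD) (lamA j) in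
  let BM j := basic_block L dt%:C (complex_mx Q) (lamA j) in
  let BPt j := basic_block L dt%:C (complex_mx QD) (lamAt j) in
  let W := space_lift L M (fourier_mx R (n + n)) in
  let Wt := space_lift L M (fourier_mx R n) in
  [/\ exists F : 'M[R[i]]_(L * M * (n + n)),
        F \in unitmx /\
        invmx F *m complex_mx T *m F =
        castmx (sum_block_sizes L M n, sum_block_sizes L M n)
          (\mxdiag_(k < n)
             (smoother_block BP BM k *m
              cgc_block (interp_lo S) (interp_hi S) (restr_lo Rs) (restr_hi Rs)
                        BPt BM k)),
      (forall j, BP j \in unitmx) /\ (forall k, BPt k \in unitmx),
      W \in unitmx /\ Wt \in unitmx
    & [/\ reorder_layers (invmx W *m complex_mx P *m W)
            = \mxdiag_(j < n + n) BP j,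
          reorder_layers (invmx W *m complex_mx Mc *m W)
            = \mxdiag_(j < n + n) BM j
        & reorder_layers (invmx Wt *m complex_mx Pt *m Wt)
            = \mxdiag_(k < n) BPt k]].
Proof.
move=> Mc P Pt TCF TFC T BP BM BPt W Wt.
have N0 : (0 < n + n)%N by rewrite addn_gt0 n_gt0.
have [uW invW] : W \in unitmx /\ invmx W = _ := space_fourier_unitmx R L M N0.
have [uWt invWt] : Wt \in unitmx /\ invmx Wt = _ := space_fourier_unitmx R L M n_gt0.
have hP : invmx W *m complex_mx P *m W = tens_diag BP by apply: system_mx_fourier.
have hM : invmx W *m complex_mx Mc *m W = tens_diag BM by apply: system_mx_fourier.
have hPt : invmx Wt *m complex_mx Pt *m Wt = tens_diag BPt by apply: system_mx_fourier.
have ucP : complex_mx P \in unitmx by rewrite map_unitmx.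
have ucPt : complex_mx Pt \in unitmx by rewrite map_unitmx.
have hS : invmx W *m complex_mx TCF *m Wt = 1%:M *t interp_hat S.
  by rewrite invW /complex_mx map_space_lift -!space_liftM space_liftE.
have hR : invmx Wt *m complex_mx TFC *m W = 1%:M *t restr_hat Rs.
  by rewrite invWt /complex_mx map_space_lift -!space_liftM space_liftE.
have S0 i k : i != k -> interp_hat S (lshift n i) k = 0 /\ interp_hat S (rshift n i) k = 0.
  by move=> /alias_neq_mod[? ?]; split; apply: interp_hat_eq0.
have R0 i k : i != k -> restr_hat Rs k (lshift n i) = 0 /\ restr_hat Rs k (rshift n i) = 0.
  by move=> /alias_neq_mod[? ?]; split; apply: restr_hat_eq0.
have cT : complex_mx T =
    (1%:M - invmx (complex_mx P) *m complex_mx Mc) *m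
    (1%:M - complex_mx TCF *m invmx (complex_mx Pt) *m complex_mx TFC *m complex_mx Mc).
  rewrite /complex_mx -!map_invmx -!map_mxM -[1%:M](map_mx1 (real_complex R)).
  by rewrite -!map_mxB -map_mxM.
rewrite cT.
clearbody Mc P Pt TCF TFC T BP BM BPt W Wt.
split.
- exact: two_grid_block_diagonalization uW uWt ucP ucPt hP hM hPt hS hR S0 R0.
- by split=> j; apply: tens_diag_unitmx; rewrite -?hP -?hPt; apply: similar_unitmx.
- by split.
- by rewrite hP hM hPt !reorder_tens_diag.
Qed.
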